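(* Let $r\ge 2$, $n\ge 1$, $N\ge 1$ be integers. Let $\tilde\nu$ be the probability distribution on $G(r,1,n)$ given by $\tilde\nu(g)=\frac{1}{n!}p(I_0,gI_0)$, where $p(b,c)=\frac{1}{(r-1)n}$ if the tuples $b,c\in B(r,n)$ differ in exactly one coordinate and $p(b,c)=0$ otherwise. Then for every $g=(x_1,\dots,x_n;\sigma)\in G(r,1,n)$, $$\tilde\nu^{*N}(g)=\frac{1}{r^n n!}\sum_{k_0=0}^{n}\left(\frac{rk_0-n}{n(r-1)}\right)^N e_{n-k_0}(\Phi_1,\dots,\Phi_n),$$ where $\Phi_i=\xi^{x_i}+\xi^{2x_i}+\cdots+\xi^{(r-1)x_i}$, that is, $\Phi_i=r-1$ if $x_i=0$ and $\Phi_i=-1$ if $x_i\ne 0$, and $e_j$ denotes the $j$-th elementary symmetric polynomial.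
   Context: $G(r,1,n)=\mathbb{Z}/r\mathbb{Z}\wr S_n$, with elements $(x_1,\dots,x_n;\sigma)$ ($x_i\in\mathbb{Z}/r\mathbb{Z}$, $\sigma\in S_n$) and multiplication $(x_i;\sigma)(y_i;\tau)=(x_i+y_{\sigma^{-1}(i)};\sigma\tau)$. $B(r,n)=\{(b_1,\dots,b_n)\mid 0\le b_i\le r-1\}$, on which $G(r,1,n)$ acts by $(x_1,\dots,x_n;\sigma)(b_i)_i=(x_i+b_{\sigma^{-1}(i)} \bmod r)_i$, and $I_0=(0,\dots,0)\in B(r,n)$. $\xi$ is a primitive $r$-th root of unity in $\mathbb{C}$. $\tilde\nu^{*N}$ is the $N$-th convolution power: $\tilde\nu^{*1}=\tilde\nu$ and $(f*h)(g)=\sum_{x\in G(r,1,n)}f(x)h(x^{-1}g)$, i.e. $\tilde\nu^{*N}(g)=\sum_{x_1,\dots,x_{N-1}\in G(r,1,n)}\tilde\nu(x_1)\tilde\nu(x_1^{-1}x_2)\cdots\tilde\nu(x_{N-1}^{-1}g)$. *)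

(* Defs.v *)
From HB Require Import structures.
From mathcomp Require Import all_boot all_order all_fingroup all_algebra.
From mathcomp Require Import reals complex mpoly.

Set Implicit Arguments.
Unset Strict Implicit.
Unset Printing Implicit Defensive.

Import Order.TTheory GRing.Theory Num.Theory.
Local Open Scope ring_scope.

(* 'Z_r is the ring of residues 0, ..., r - 1 only when 1 < r, which every
   result below assumes. *)
Record wreath (r n : nat) :=
  Wreath { wvec : {ffun 'I_n -> 'Z_r}; wperm : 'S_n }.

Section WreathFinite.
Variables r n : nat.

Definition wreath_pair (g : wreath r n) := (wvec g, wperm g).
Definition pair_wreath (u : {ffun 'I_n -> 'Z_r} * 'S_n) : wreath r n :=
  Wreath u.1 u.2.

Lemma wreath_pairK : cancel wreath_pair pair_wreath.
Proof. by case. Qed.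

HB.instance Definition _ := Finite.copy (wreath r n) (can_type wreath_pairK).

End WreathFinite.

Section WreathGroup.
Variables r n : nat.
Implicit Types g h k : wreath r n.

(* MathComp composes permutations from left to right, (s * t) i = t (s i), so
   the composite sigma \o tau is written wperm h * wperm g. *)
Definition wreath_mul g h : wreath r n :=
  Wreath [ffun i => wvec g i + wvec h ((wperm g)^-1%g i)]
         (wperm h * wperm g)%g.

Definition wreath_one : wreath r n := Wreath [ffun=> 0] 1%g.

Definition wreath_inv g : wreath r n :=
  Wreath [ffun i => - wvec g (wperm g i)] (wperm g)^-1%g.

Lemma wreath_mulA : associative wreath_mul.
Proof.
move=> g h k; congr Wreath; last by rewrite mulgA.
by apply/ffunP => i; rewrite !ffunE /= invMg permM addrA.
Qed.

Lemma wreath_mul1 : left_id wreath_one wreath_mul.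
Proof.
case=> x s; congr Wreath; last by rewrite /= mulg1.
by apply/ffunP => i; rewrite !ffunE /= invg1 perm1 add0r.
Qed.

Lemma wreath_mulV : left_inverse wreath_one wreath_inv wreath_mul.
Proof.
move=> g; congr Wreath; last by rewrite /= mulgV.
by apply/ffunP => i; rewrite !ffunE /= invgK addNr.
Qed.

HB.instance Definition _ :=
  Finite_isGroup.Build (wreath r n) wreath_mulA wreath_mul1 wreath_mulV.

End WreathGroup.

Notation "''G' ( r , 1 , n )" := (wreath r n)
  (at level 8, format "''G' ( r ,  1 ,  n )") : type_scope.

(* For 1 < r, the elements of 'Z_r are the integers b with 0 <= b <= r - 1,
   and its addition is the addition of integers reduced mod r. *)
Notation "''B' ( r , n )" := {ffun 'I_n -> 'Z_r}
  (at level 8, format "''B' ( r ,  n )", only parsing) : type_scope.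

Section Distribution.
Variables (R : realType) (r n : nat).

Definition wact (g : 'G(r, 1, n)) (b : 'B(r, n)) : 'B(r, n) :=
  [ffun i => wvec g i + b ((wperm g)^-1%g i)].

Lemma wact1 b : wact 1%g b = b.
Proof. by apply/ffunP => i; rewrite !ffunE /= invg1 perm1 add0r. Qed.

Lemma wactM g h b : wact (g * h)%g b = wact g (wact h b).
Proof. by apply/ffunP => i; rewrite !ffunE /= invMg permM addrA. Qed.

Definition I0 : 'B(r, n) := [ffun=> 0].

Definition hamming_step (b c : 'B(r, n)) : R :=
  if #|[set i | b i != c i]| == 1%N then ((r%:R - 1) * n%:R)^-1 else 0.

Definition nu (g : 'G(r, 1, n)) : R := (n`!%:R)^-1 * hamming_step I0 (wact g I0).

End Distribution.

Section Convolution.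
Variables (R : realType) (gT : finGroupType).

Definition conv (f h : gT -> R) (g : gT) : R :=
  \sum_(x : gT) f x * h (x^-1 * g)%g.

(* iterop N op f e is op f (... (op f f)) with N copies of f, and e when
   N = 0; here e is the unit for conv. *)
Definition conv_pow (f : gT -> R) (N : nat) : gT -> R :=
  iterop N conv f (fun g => (g == 1%g)%:R).

End Convolution.

Section NuProbability.
Variables (R : realType) (r n : nat).

Lemma nu_ge0 (g : 'G(r, 1, n)) : (1 < r)%N -> 0 <= nu R g.
Proof.
move=> r1; rewrite /nu mulr_ge0 ?invr_ge0 ?ler0n // /hamming_step.
case: ifP => // _; rewrite invr_ge0 mulr_ge0 ?ler0n // subr_ge0 ler1n.
exact: ltnW.
Qed.

Lemma sum_nu : (1 < r)%N -> (0 < n)%N -> \sum_(g : 'G(r, 1, n)) nu R g = 1.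
Proof.
move=> r1 n0.
rewrite (reindex (@pair_wreath r n)) /=; last first.
  by exists (@wreath_pair r n) => [[]|] // [].
rewrite -(pair_bigA _ (fun x s => nu R (Wreath x s))) /=.
have actI0 (x : 'B(r, n)) s : wact (Wreath x s) (I0 r n) = x.
  by apply/ffunP => i; rewrite !ffunE addr0.
under eq_bigr do under eq_bigr do rewrite /nu actI0.
have nf0 : n`!%:R != 0 :> R by rewrite pnatr_eq0 -lt0n fact_gt0.
under eq_bigr do rewrite sumr_const card_Sn -[_ *+ n`!]mulr_natl mulVKf //.
rewrite -big_mkcond /= sumr_const.
have r0 : (0 < r)%N by apply: ltnW.
have dE : (r%:R - 1) * n%:R = (r.-1 * n)%:R :> R.
  by rewrite natrM -subn1 natrB.
suff -> : #|[pred x : 'B(r, n) | #|[set i | I0 r n i != x i]| == 1%N]|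
          = (r.-1 * n)%N.
  rewrite dE -[_ *+ _]mulr_natl divff // pnatr_eq0 -lt0n muln_gt0 n0 andbT.
  by case: (r) r1 => [|[]].
pose f (u : 'I_n * 'Z_r) : 'B(r, n) := [ffun j => if j == u.1 then u.2 else 0].
pose A := setX [set: 'I_n] [set~ (0 : 'Z_r)].
have injf : {in A &, injective f}.
  move=> [i a] [j b]; rewrite !inE /= => a0 b0 /ffunP E.
  have := E i; rewrite !ffunE /= eqxx; case: eqP => [-> -> //|_ a0'].
  by rewrite a0' eqxx in a0.
have -> : (r.-1 * n)%N = #|f @: A|.
  rewrite card_in_imset // cardsX cardsT card_ord cardsC1 card_ord Zp_cast //.
  by rewrite mulnC.
apply: eq_card => x; rewrite inE.
apply/idP/imsetP => [/cards1P[i /setP E]|[[i a]]].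
  exists (i, x i).
    by have := E i; rewrite !inE ffunE eqxx eq_sym /= => ->.
  apply/ffunP => j; rewrite ffunE /=; case: eqP => [-> //|/eqP ji].
  by have := E j; rewrite !inE ffunE (negbTE ji) eq_sym => /negbFE/eqP.
rewrite !inE /= => a0 ->; apply/cards1P; exists i; apply/setP => j.
by rewrite !inE !ffunE /=; case: (j =P i); rewrite ?eqxx // eq_sym a0.
Qed.

End NuProbability.

Definition Phi (R : realType) (r n : nat) (xi : R[i]) (g : 'G(r, 1, n))
    (i : 'I_n) : R[i] :=
  \sum_(1 <= k < r) xi ^+ (k * wvec g i)%N.

Definition elem_sym (C : comNzRingType) (n k : nat) (v : 'I_n -> C) : C :=
  (mesym n C k).@[v].

(* Main.v *)
(* Convolving with nu averages a function of the coordinate vector over all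
   changes of exactly one coordinate, up to a permutation of the coordinates
   that the symmetric functions e_j (Phi) do not see. Each e_(n - k) (Phi) is an
   eigenfunction of this average, with eigenvalue (r k - n) / (n (r - 1)). The sum
   of the e_(n - k) (Phi) over k is the product of the 1 + Phi_i, which is r ^ n
   at the zero vector and 0 elsewhere, so applying the average N times to it
   gives the formula. *)
Require Import Defs.
From mathcomp Require Import all_boot all_order all_fingroup all_algebra.
From mathcomp Require Import ring reals complex mpoly.

Set Implicit Arguments.
Unset Strict Implicit.
Unset Printing Implicit Defensive.

Import GRing.Theory Num.Theory.

Local Open Scope ring_scope.
Local Open Scope complex_scope.

(** * Elementary symmetric polynomials as coefficients of a product of linear factors *)

Lemma deriv_prod (A : comNzRingType) (I : eqType) (s : seq I)
    (F : I -> {poly A}) : uniq s ->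
  (\prod_(i <- s) F i)^`() =
  \sum_(i <- s) (F i)^`() * \prod_(j <- s | j != i) F j.
Proof.
elim: s => [|i s IH] /=; first by rewrite !big_nil -[1]/(1%:P) derivC.
case/andP=> is_s /IH Es; rewrite !big_cons derivM Es eqxx /=; congr (_ * _ + _).
  rewrite [RHS]big_seq_cond [LHS]big_seq; apply: eq_bigl => j.
  by case: eqP => [->|]; rewrite ?(negbTE is_s) ?andbT.
rewrite mulr_sumr !big_seq; apply: eq_bigr => j js.
have ij : i != j by apply: contraNneq is_s => ->.
by rewrite big_cons ij mulrCA.
Qed.

Section ElemSym.
Variables (C : comNzRingType) (n : nat).
Implicit Types v : 'I_n -> C.

Lemma elem_symE k v :
  elem_sym k v = \sum_(h : {set 'I_n} | #|h| == k) \prod_(i in h) v i.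
Proof.
rewrite /elem_sym mesymE raddf_sum; apply: eq_bigr => h _.
rewrite /= mevalX [RHS]big_mkcond; apply: eq_bigr => i _.
by rewrite mnmE; case: (i \in h); rewrite ?expr1 ?expr0.
Qed.

Lemma eq_elem_sym k v w : v =1 w -> elem_sym k v = elem_sym k w.
Proof. by move=> vw; rewrite /elem_sym; apply: meval_eq. Qed.

(** When the product is expanded, taking the constants on a set [h] of factors leaves ['X] to the
    power [n - #|h|]. *)
Lemma coef_prodXD k v : (k <= n)%N ->
  (\prod_i ('X + (v i)%:P))`_k = elem_sym (n - k) v.
Proof.
move=> kn; under eq_bigr do rewrite addrC.
rewrite bigA_distr coef_sum elem_symE [RHS]big_mkcond; apply: eq_bigr => h _.
rewrite (bigID (mem h)) /= (eq_bigr (fun i => (v i)%:P)) => [|i -> //].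
rewrite -rmorph_prod [X in _ * X](eq_bigr (fun=> 'X)) => [|i /negbTE-> //].
have -> : \prod_(i | i \notin h) 'X = 'X^(n - #|h|) :> {poly C}.
  rewrite prodr_const -[X in (X - _)%N](card_ord n) -(cardC h) addKn.
  by congr (_ ^+ _); apply: eq_card.
rewrite coefCM coefXn.
have hn : (#|h| <= n)%N by rewrite -[leqRHS](card_ord n) max_card.
have -> : (k == n - #|h|)%N = (#|h| == n - k)%N.
  by apply/eqP/eqP => ->; rewrite subKn.
by case: eqP; rewrite ?mulr1 ?mulr0.
Qed.

(** Read as coefficient [n - k] of the product, the value depends only on the unordered family of
    factors. *)
Lemma elem_sym_perm k v (s : 'S_n) :
  (k <= n)%N -> elem_sym k (v \o s) = elem_sym k v.
Proof.
move=> kn; rewrite -{1 2}(subKn kn) -!coef_prodXD ?leq_subr //.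
by rewrite [in RHS](reindex_inj (@perm_inj _ s)).
Qed.

(** The coefficients of a polynomial add up to its value at 1. *)
Lemma sum_elem_sym v : \sum_(0 <= k < n.+1) elem_sym (n - k) v = \prod_i (1 + v i).
Proof.
have := horner_prod (index_enum 'I_n) xpredT (fun i => 'X + (v i)%:P) 1.
under [RHS]eq_bigr do rewrite hornerD hornerX hornerC.
move=> <-; rewrite (@horner_coef_wide _ n.+1); last first.
  apply/leq_sizeP => j nj; under eq_bigr do rewrite -[(v _)%:P]opprK -polyCN.
  rewrite nth_default // size_prod_XsubC.
  by rewrite /index_enum -enumT size_enum_ord.
rewrite big_mkord; apply: eq_bigr => k _.
by rewrite expr1n mulr1 coef_prodXD // -ltnS.
Qed.

End ElemSym.

(** Serves for the embedding of [R] into [R[i]]: [nu] is real, [Phi] complex. *)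
Lemma elem_sym_rmorph (A B : comNzRingType) (f : {rmorphism A -> B}) n k
  (v : 'I_n -> A) : elem_sym k (f \o v) = f (elem_sym k v).
Proof.
rewrite !elem_symE rmorph_sum; apply: eq_bigr => h _.
by rewrite rmorph_prod.
Qed.

(** * The walk that changes one coordinate, and its eigenfunctions *)

Section Walk.
Variables (r n : nat).
Hypothesis r_gt1 : (1 < r)%N.

Definition single (i : 'I_n) (c : 'Z_r) : 'B(r, n) :=
  [ffun j => if j == i then c else 0].

(** The value of [Phi] at a coordinate [c], free of roots of unity, so that the walk can be studied
    over [R]. *)
Definition phi (A : pzRingType) (c : 'Z_r) : A :=
  if c == 0 then r%:R - 1 else - 1.

Lemma phi_sum (A : pzRingType) : \sum_c phi A c = 0.
Proof.
rewrite (bigD1 0) //= /phi eqxx (eq_bigr (fun=> -1)) => [|c /negbTE-> //].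
rewrite sumr_const cardC1 card_ord Zp_cast // mulNrn -subn1 natrB ?(ltnW r_gt1) //.
by rewrite subrr.
Qed.

(** A vector of weight one is [single i c] for just one pair with [c != 0]: its nonzero position and
    the value there. *)
Lemma sum_weight1 (V : nmodType) (F : 'B(r, n) -> V) :
  \sum_(a : 'B(r, n) | #|[set i | I0 r n i != a i]| == 1%N) F a =
  \sum_i \sum_(c | c != 0) F (single i c).
Proof.
rewrite pair_big /=.
pose f (u : 'I_n * 'Z_r) := single u.1 u.2.
have injf : {in [pred u : 'I_n * 'Z_r | u.2 != 0] &, injective f}.
  move=> [i a] [j b] /=; rewrite !inE /= => a0 b0 /ffunP E.
  have := E i; rewrite !ffunE /= eqxx; case: eqP => [-> -> //|_ a0'].
  by rewrite a0' eqxx in a0.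
rewrite -(big_imset F injf) /=; apply: eq_bigl => x.
apply/idP/imsetP => [/cards1P[i /setP E]|[[i a]]].
  exists (i, x i).
    by have := E i; rewrite !inE ffunE eqxx eq_sym /= => ->.
  apply/ffunP => j; rewrite ffunE /=; case: eqP => [-> //|/eqP ji].
  by have := E j; rewrite !inE ffunE (negbTE ji) eq_sym => /negbFE/eqP.
rewrite !inE /= => a0 ->; apply/cards1P; exists i; apply/setP => j.
by rewrite !inE !ffunE /=; case: (j =P i); rewrite ?eqxx // eq_sym a0.
Qed.

(* With P_b := \prod_i ('X + phi (b i)), moving one coordinate replaces the
   factor 'X + phi (b i) by (r - 1) 'X - phi (b i) = r 'X - ('X + phi (b i)),
   so the sum over all moves is r 'X P_b' - n P_b. *)
Lemma elem_sym_eigen (A : comNzRingType) (b : 'B(r, n)) k : (k <= n)%N ->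
  \sum_i \sum_(c | c != 0)
    elem_sym (n - k) (fun j => phi A (b j - single i c j)) =
  (r%:R * k%:R - n%:R) * elem_sym (n - k) (fun j => phi A (b j)).
Proof.
move=> kn; pose P (b : 'I_n -> 'Z_r) : {poly A} := \prod_j ('X + (phi A (b j))%:P).
pose Q i : {poly A} := \prod_(j | j != i) ('X + (phi A (b j))%:P).
have moveE i c : P (fun j => b j - single i c j) =
    ('X + (phi A (b i - c))%:P) * Q i.
  rewrite /P (bigD1 i) //= ffunE eqxx; congr (_ * _).
  by apply: eq_bigr => j /negbTE ji; rewrite ffunE ji subr0.
have PE i : P b = ('X + (phi A (b i))%:P) * Q i by rewrite /P (bigD1 i).
have sum_phi x : \sum_(c : 'Z_r | c != 0) ('X + (phi A (x - c))%:P) =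
    r%:R * 'X - ('X + (phi A x)%:P).
  have : \sum_(c : 'Z_r) ('X + (phi A (x - c))%:P) = r%:R * 'X.
    have cardZ : #|'Z_r| = r by rewrite card_ord Zp_cast.
    rewrite big_split sumr_const cardZ /= -rmorph_sum /=.
    rewrite (reindex_inj (inj_comp (addrI x) oppr_inj)) /=.
    under eq_bigr do rewrite opprD opprK addNKr.
    by rewrite phi_sum addr0 mulr_natl.
  by move=> <-; rewrite [in RHS](bigD1 0) //= subr0 addrAC subrr add0r.
transitivity ((\sum_i \sum_(c | c != 0) P (fun j => b j - single i c j))`_k).
  rewrite coef_sum; apply: eq_bigr => i _; rewrite coef_sum.
  by apply: eq_bigr => c _; rewrite coef_prodXD.
have -> : \sum_i \sum_(c | c != 0) P (fun j => b j - single i c j) =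
    r%:R * ('X * (P b)^`()) - n%:R * P b.
  rewrite deriv_prod ?index_enum_uniq // !mulr_sumr.
  have -> : n%:R * P b = \sum_(i < n) P b by rewrite sumr_const card_ord mulr_natl.
  rewrite -sumrB; apply: eq_bigr => i _.
  rewrite (eq_bigr _ (fun c _ => moveE i c)) -mulr_suml sum_phi mulrBl -PE.
  by rewrite derivD derivX derivC addr0 mul1r !mulrA.
(* Coefficient [k] of ['X] times the derivative is [k] times that of the polynomial, also for
   [k = 0], where both vanish; hence the eigenvalue. *)
rewrite mulrBl -mulrA !mulr_natl coefB !coefMn coefXM -(coef_prodXD _ kn).
by congr (_ *+ _ - _); case: (k) => [|m] //=; rewrite coef_deriv.
Qed.

(** A zero coordinate gives a factor [r], a nonzero one gives 0. *)
Lemma prod_1phi (A : comNzRingType) (b : 'B(r, n)) :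
  \prod_i (1 + phi A (b i)) = (r ^ n)%:R * (b == I0 r n)%:R.
Proof.
case: eqP => [->|/eqP b0].
  under eq_bigr do rewrite ffunE /phi eqxx addrC subrK.
  by rewrite prodr_const card_ord mulr1 natrX.
have [i bi] : exists i, b i != 0.
  apply/existsP; apply: contraNT b0 => /existsPn b0; apply/eqP/ffunP => i.
  by rewrite ffunE; apply/eqP/negPn/b0.
by rewrite (bigD1 i) //= /phi (negbTE bi) subrr mul0r mulr0.
Qed.

End Walk.

(** * Convolution powers of [nu] over the reals *)

Section Convolution.
Variables (R : realType) (r n : nat).
Hypothesis r_gt1 : (1 < r)%N.

(** The vector of [(Wreath x s)^-1 * g] is [wvec g - x] composed with [s]. By the invariance of [F]
    all [n!] permutations contribute equally, which cancels the factor [1 / n!] of [nu]. *)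
Lemma conv_nu (f : 'G(r, 1, n) -> R) (F : ('I_n -> 'Z_r) -> R) g :
  (forall b c (s : 'S_n), b =1 c \o s -> F b = F c) ->
  (forall h, f h = F (wvec h)) ->
  conv (@nu R r n) f g = ((r%:R - 1) * n%:R)^-1 *
    \sum_i \sum_(c | c != 0) F (fun j => wvec g j - single i c j).
Proof.
move=> Fs fF; rewrite /conv (reindex (@pair_wreath r n)) /=; last first.
  by exists (@wreath_pair r n) => [[]|] // [].
rewrite -(pair_bigA _ (fun x s => nu R (Wreath x s) * f ((Wreath x s)^-1 * g)%g)) /=.
have actI0 (x : 'B(r, n)) s : wact (Wreath x s) (I0 r n) = x.
  by apply/ffunP => i; rewrite !ffunE addr0.
rewrite -(sum_weight1 (fun a => F (fun j => wvec g j - a j))).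
rewrite mulr_sumr [RHS]big_mkcond; apply: eq_bigr => x _.
have nf0 : n`!%:R != 0 :> R by rewrite pnatr_eq0 -lt0n fact_gt0.
under eq_bigr => s _.
  rewrite /nu actI0 fF (Fs _ (fun j => wvec g j - x j) s); last first.
    by move=> j; rewrite !ffunE /= invgK addrC.
  over.
rewrite sumr_const card_Sn -[_ *+ n`!]mulr_natl !mulrA divff // mul1r.
by rewrite /hamming_step; case: ifP; rewrite ?mul0r.
Qed.

Lemma conv_pow_nu N (g : 'G(r, 1, n)) : (0 < N)%N ->
  conv_pow (@nu R r n) N g = (r ^ n * n`!)%N%:R^-1 *
    \sum_(0 <= k < n.+1) ((r%:R * k%:R - n%:R) / (n%:R * (r%:R - 1))) ^+ N *
      elem_sym (n - k) (fun i => phi R (wvec g i)).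
Proof.
move=> N_gt0.
pose lam k : R := (r%:R * k%:R - n%:R) / (n%:R * (r%:R - 1)).
pose F N (b : 'I_n -> 'Z_r) : R := (r ^ n * n`!)%N%:R^-1 *
  \sum_(0 <= k < n.+1) lam k ^+ N * elem_sym (n - k) (fun i => phi R (b i)).
have FS N' b c (s : 'S_n) : b =1 c \o s -> F N' b = F N' c.
  move=> bc; congr (_ * _); apply: eq_bigr => k _; congr (_ * _).
  rewrite -(elem_sym_perm (fun i => phi R (c i)) s) ?leq_subr //.
  by apply: eq_elem_sym => i; rewrite /= bc.
have stepE N' (b : 'B(r, n)) : ((r%:R - 1) * n%:R)^-1 *
    \sum_i \sum_(c | c != 0) F N' (fun j => b j - single i c j) = F N'.+1 b.
  rewrite /F; under eq_bigr do rewrite -mulr_sumr exchange_big.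
  rewrite -mulr_sumr exchange_big mulrCA mulr_sumr; congr (_ * _).
  rewrite !big_nat; apply: eq_bigr => k /andP[_ kn].
  under eq_bigr do rewrite -mulr_sumr.
  rewrite -mulr_sumr elem_sym_eigen // exprS [(_ - 1) * _]mulrC.
  by rewrite [lam k in RHS]/lam; ring.
(* The induction starts at 1: [F 0] is [1 / n!] on all elements with zero vector, not the
   convolution unit, but one averaging step takes it to [nu]. *)
case: N N_gt0 g => // N _; elim: N => [|N IH] g.
  rewrite -[RHS]/(F 1%N _) -stepE.
  have F0 (b : 'B(r, n)) : F 0%N b = n`!%:R^-1 * (b == I0 r n)%:R.
    rewrite /F; under eq_bigr do rewrite mul1r.
    rewrite sum_elem_sym prod_1phi // natrM invfM mulrACA.
    by rewrite mulVf ?mul1r // pnatr_eq0 -lt0n expn_gt0 ltnW.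
  rewrite -(sum_weight1 (fun a => F 0%N (fun j => wvec g j - a j))).
  have F0B (a : 'B(r, n)) :
      F 0%N (fun j => wvec g j - a j) = n`!%:R^-1 * (a == wvec g)%:R.
    (* The identity permutation turns [FS] into extensionality, to pass from a function to a finite
       function. *)
    rewrite -(FS 0%N (wvec g - a) _ 1%g); last by move=> j; rewrite !ffunE /= perm1.
    have I00 : I0 r n = 0 by apply/ffunP => j; rewrite !ffunE.
    by rewrite F0 I00 subr_eq0 eq_sym.
  rewrite (eq_bigr _ (fun a _ => F0B a)) -mulr_sumr big_mkcond (bigD1 (wvec g)) //=.
  rewrite big1 => [|a /negbTE ->]; last by case: ifP.
  have actI0 : wact g (I0 r n) = wvec g.
    by apply/ffunP => i; rewrite !ffunE addr0.
  rewrite eqxx addr0 mulrCA /conv_pow /= /nu actI0 /hamming_step.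
  by case: ifP; rewrite ?mulr1 ?mulr0.
rewrite -[LHS]/(conv (@nu R r n) (conv_pow (@nu R r n) N.+1) g).
by rewrite (conv_nu _ (FS N.+1)) // stepE.
Qed.

End Convolution.

(** * Values of [Phi] from the root of unity, and passage to the complex numbers *)

Lemma PhiE (R : realType) (r n : nat) (xi : R[i]) (g : 'G(r, 1, n)) i :
  (1 < r)%N -> r.-primitive_root xi -> Phi xi g i = phi _ (wvec g i).
Proof.
move=> r_gt1 xi_prim; rewrite /Phi /phi.
have sumE : \sum_(0 <= k < r) (xi ^+ wvec g i) ^+ k =
    1 + \sum_(1 <= k < r) xi ^+ (k * wvec g i).
  rewrite big_ltn ?(ltnW r_gt1) // expr0; congr (1 + _).
  by apply: eq_bigr => k _; rewrite -exprM mulnC.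
case: eqP => [->|/eqP gi0].
  under eq_bigr do rewrite muln0 expr0.
  by rewrite big_const_nat iter_addr addr0 natrB // ltnW.
(* With [z = xi ^+ wvec g i], the full geometric sum times [z - 1] is [z ^+ r - 1 = 0], and [z] is
   not 1 because the exponent lies strictly between 0 and [r]. *)
apply/eqP; rewrite -addr_eq0 addrC -sumE big_mkord.
have xi1 : xi ^+ wvec g i - 1 != 0.
  rewrite subr_eq0 -(prim_order_dvd xi_prim) gtnNdvd //; first by rewrite lt0n.
  by rewrite -[ltnRHS](Zp_cast r_gt1) ltn_ord.
rewrite -(mulrI_eq0 _ (mulfI xi1)) -subrX1 -exprM mulnC exprM.
by rewrite (prim_expr_order xi_prim) expr1n subrr.
Qed.

Theorem theorem3p4 (R : realType) (r n N : nat) (xi : R[i])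
    (g : 'G(r, 1, n)) :
  (2 <= r)%N -> (1 <= n)%N -> (1 <= N)%N -> r.-primitive_root xi ->
  (forall i : 'I_n,
     Phi xi g i = if wvec g i == 0 then r%:R - 1 else - 1) /\
  (conv_pow (@nu R r n) N g)%:C =
    (r ^ n * n`!)%N%:R^-1 *
      \sum_(0 <= k0 < n.+1)
        ((r%:R * k0%:R - n%:R) / (n%:R * (r%:R - 1))) ^+ N *
          elem_sym (n - k0) (Phi xi g).
Proof.
move=> r_gt1 n_gt0 N_gt0 xi_prim; split=> [i|]; first exact: PhiE.
rewrite conv_pow_nu // rmorphM fmorphV rmorph_nat rmorph_sum; congr (_ * _).
apply: eq_bigr => k _; rewrite rmorphM rmorphXn fmorph_div rmorphB !rmorphM.
rewrite rmorphB rmorph1 !rmorph_nat -elem_sym_rmorph; congr (_ * _).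
apply: eq_elem_sym => i; rewrite PhiE //= /phi.
by case: ifP; rewrite ?rmorphN ?rmorphB rmorph1 ?rmorph_nat.
Qed.
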